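(* Let $M$ be a smooth $7$-manifold with a $G_2$-structure $\varphi$ with associated metric $g$, with octonion bundle $\mathbb{O}M$ and octonion covariant derivative $D$. Suppose $A,B\in\Gamma(\mathbb{O}M)$ and $X\in\Gamma(TM)$. Then $$\nabla_X\left(g(A,B)\right)=g(D_XA,B)+g(A,D_XB).$$
   Context: Setting. A $G_2$-structure on a smooth $7$-manifold $M$ is identified with a positive $3$-form $\varphi$, i.e. one that at each point lies in the $GL(7,\mathbb{R})$-orbit of $\varphi_0=e^{123}+e^{145}+e^{167}+e^{246}-e^{257}-e^{347}-e^{356}$. It determines a unique Riemannian metric $g$ and volume form $\mathrm{vol}$ (hence an orientation) by $g(u,v)\,\mathrm{vol}=\frac16(u\lrcorner\varphi)\wedge(v\lrcorner\varphi)\wedge\varphi$, where $\lrcorner$ is contraction. Let $*$ be the Hodge star, $\psi=*\varphi$, and $\nabla$ the Levi-Civita connection of $g$. Octonion bundle. $\mathbb{O}M=\Lambda^0\oplus TM$, where $\Lambda^0$ is the trivial real line bundle; an octonion section is $A=(a,\alpha)$ with $a=\mathrm{Re}A$ a function and $\alpha=\mathrm{Im}A$ a vector field. The metric is extended to $\mathbb{O}M$ by $g(A,B)=\langle A,B\rangle=(\mathrm{Re}A)(\mathrm{Re}B)+g(\mathrm{Im}A,\mathrm{Im}B)$. Cross product: $\langle\alpha\times\beta,\gamma\rangle=\varphi(\alpha,\beta,\gamma)$. Octonion product: $(a,\alpha)(b,\beta)=(ab-\langle\alpha,\beta\rangle,\ a\beta+b\alpha+\alpha\times\beta)$. Torsion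 and $D$. The torsion tensor $T_{ab}$ of $\varphi$ is the $2$-tensor with $\nabla_a\varphi_{bcd}=2T_a{}^{e}\psi_{ebcd}$. For a vector field $X$, $T_X=(0,X\lrcorner T)$ is the imaginary octonion section with vector part $X^aT_a{}^b$. Set $\nabla_X(a,\alpha)=(\nabla_Xa,\nabla_X\alpha)$ and define $D_XA=\nabla_XA-A\,T_X$ (octonion product). *)

(* Defs.v *)
From HB Require Import structures.
From mathcomp Require Import all_boot all_order all_algebra all_fingroup.
From mathcomp Require Import all_classical all_reals all_analysis.

Set Implicit Arguments.
Unset Strict Implicit.
Unset Printing Implicit Defensive.

Import Order.TTheory GRing.Theory Num.Theory.
Import numFieldNormedType.Exports.
Local Open Scope classical_set_scope.
Local Open Scope ring_scope.

Section MultilinearAlgebra.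
Context {R : realType}.
Implicit Types V W : lmodType R.

Definition kform (k : nat) V := k.-tuple V -> R.

Definition subst_tuple k (E : Type) (v : k.-tuple E) (i : 'I_k) (x : E) :
  k.-tuple E := [tuple if j == i then x else tnth v j | j < k].

Definition multilinear_form k V (w : kform k V) :=
  forall (v : k.-tuple V) (i : 'I_k) (a : R) (x y : V),
    w (subst_tuple v i (a *: x + y)) =
    a * w (subst_tuple v i x) + w (subst_tuple v i y).

Definition alternating_form k V (w : kform k V) :=
  multilinear_form w /\
  forall (v : k.-tuple V) (i j : 'I_k), i != j -> tnth v i = tnth v j -> w v = 0.

Definition contract k V (u : V) (w : kform k.+1 V) : kform k V :=
  fun v => w [tuple of u :: v].

(* Normalised so that (e^1 /\ ... /\ e^k)(e_1, ..., e_k) = 1. *)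
Definition wedge_form k l V (w1 : kform k V) (w2 : kform l V) : kform (k + l) V :=
  fun v => (k`!%:R * l`!%:R)^-1 *
    \sum_(s : 'S_(k + l)) (-1) ^+ s *
      w1 [tuple tnth v (s (lshift l i)) | i < k] *
      w2 [tuple tnth v (s (rshift k i)) | i < l].

Definition pullback k V W (L : V -> W) (w : kform k W) : kform k V :=
  fun v => w (map_tuple L v).

(* The i-th coordinate covector e^i of R^7, with 1 <= i <= 7. *)
Definition covec (i : nat) : kform 1 'rV[R]_7 :=
  fun v => (thead v) ord0 (inord i.-1).

Definition covec3 (i j k : nat) : kform 3 'rV[R]_7 :=
  wedge_form (wedge_form (covec i) (covec j)) (covec k).

Definition phi0 : kform 3 'rV[R]_7 := fun v =>
  covec3 1 2 3 v + covec3 1 4 5 v + covec3 1 6 7 v + covec3 2 4 6 v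
  - covec3 2 5 7 v - covec3 3 4 7 v - covec3 3 5 6 v.

Definition positive_3form V (phi : kform 3 V) :=
  exists2 L : {linear V -> 'rV[R]_7}, bijective L & phi = pullback L phi0.

Definition bilinear_form V (t : V -> V -> R) :=
  (forall (a : R) (u v w : V), t (a *: u + v) w = a * t u w + t v w) /\
  (forall (a : R) (u v w : V), t w (a *: u + v) = a * t w u + t w v).

Definition inner_product V (g : V -> V -> R) :=
  [/\ bilinear_form g, forall u v, g u v = g v u &
      forall v, v != 0 -> 0 < g v v].

Definition orthonormal_basis n V (g : V -> V -> R) (e : n.-tuple V) :=
  (forall i j : 'I_n, g (tnth e i) (tnth e j) = (i == j)%:R) /\
  (forall v : V, v = \sum_(i < n) g v (tnth e i) *: tnth e i).

(* The Riemannian volume form of g, up to the choice of an orientation. *)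
Definition volume_form n V (g : V -> V -> R) (vol : kform n V) :=
  alternating_form vol /\
  forall e : n.-tuple V, orthonormal_basis g e -> `|vol e| = 1.

(* <w1, w2> = (1/k!) (w1)_{i1...ik} (w2)_{i1...ik} in the frame e. *)
Definition form_inner n k V (e : n.-tuple V) (w1 w2 : kform k V) : R :=
  k`!%:R^-1 * \sum_(f : {ffun 'I_k -> 'I_n})
    w1 [tuple tnth e (f i) | i < k] * w2 [tuple tnth e (f i) | i < k].

(* w' = *w : the l-form such that  a /\ w' = <a, w> vol  for all k-forms a. *)
Definition hodge_dual k l V (g : V -> V -> R) (vol : kform (k + l) V)
    (w : kform k V) (w' : kform l V) :=
  alternating_form w' /\
  forall (a : kform k V) (e : (k + l).-tuple V) (v : (k + l).-tuple V),
    alternating_form a -> orthonormal_basis g e ->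
    wedge_form a w' v = form_inner e a w * vol v.

(* The scaling (g, vol) -> (c g, c^-1 vol) preserves the equation below; asking
   that vol be the volume form of g is what makes the pair unique. *)
Definition metric_volume_of V (phi : kform 3 V) (g : V -> V -> R)
    (vol : kform 7 V) :=
  volume_form g vol /\
  forall (u v : V) (w : 7.-tuple V),
    g u v * vol w =
    6%:R^-1 * wedge_form (wedge_form (contract u phi) (contract v phi)) phi w.

(* The vector representing a covector, i.e. raising an index with g. It exists
   and is unique when g is an inner product in finite dimension; the default 0
   is not used. *)
Definition sharp V (g : V -> V -> R) (w : V -> R) : V :=
  xget 0 [set u : V | forall v, g u v = w v].

Definition cross_product V (g : V -> V -> R) (phi : kform 3 V) (u v : V) : V :=
  sharp g (fun w => phi [tuple u; v; w]).

Definition oct_mul V (g : V -> V -> R) (phi : kform 3 V) (x y : R^o * V) :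
    R^o * V :=
  (x.1 * y.1 - g x.2 y.2, x.1 *: y.2 + y.1 *: x.2 + cross_product g phi x.2 y.2).

Definition oct_inner V (g : V -> V -> R) (x y : R^o * V) : R :=
  x.1 * y.1 + g x.2 y.2.

End MultilinearAlgebra.

Section SmoothEuclidean.
Context {R : realType} {n : nat}.
Implicit Types (U : set 'rV[R]_n) (f : 'rV[R]_n -> R^o).

Fixpoint Ck (k : nat) U f : Prop :=
  (forall x, U x -> {for x, continuous f}) /\
  if k is k'.+1 then
    forall i : 'I_n,
      (forall x, U x -> derivable f x (delta_mx 0 i)) /\
      Ck k' U (fun x => 'D_(delta_mx 0 i) f x)
  else True.

Definition smooth_on U f := forall k, Ck k U f.

Lemma Ck_continuous k U f x : Ck k U f -> U x -> {for x, continuous f}.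
Proof. by case: k => [|k] [cf _] Ux; exact: cf. Qed.

Lemma CkW k U f : Ck k.+1 U f -> Ck k U f.
Proof.
elim: k f => [|k IHk] f [cf df]; split => // i.
by have [dfi Cfi] := df i; split => //; exact: IHk.
Qed.

Lemma eq_Ck k U f h :
  open U -> (forall x, U x -> f x = h x) -> Ck k U f -> Ck k U h.
Proof.
move=> oU; elim: k f h => [|k IHk] f h fh [cf df].
all: have nfh x : U x -> \forall y \near x, f y = h y
  by move=> Ux; exact: (filterS fh (open_nbhs_nbhs (conj oU Ux))).
all: have ch x : U x -> {for x, continuous h}
  by move=> Ux; rewrite /continuous_at /prop_for -fh//;
     apply: cvg_trans (cf x Ux); exact: (near_eq_cvg (nfh x Ux)).
  by split.
split=> // i; have [dfi Cfi] := df i; split=> [x Ux|].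
  exact: near_eq_derivable (nfh x Ux) (dfi x Ux).
by apply: IHk Cfi => x Ux; exact: near_eq_derive (nfh x Ux).
Qed.

Lemma Ck_cst k U (a : R) : Ck k U (fun=> a).
Proof.
have ca (b : R) (x : 'rV[R]_n) : {for x, continuous (fun=> b : R^o)}.
  by have FF := nbhs_filter x; exact: (@cvg_cst R^o b _ (nbhs x) FF).
elim: k a => [|k IHk] a; split => // i.
split=> [x _|]; first exact: derivable_cst.
suff -> : (fun x => 'D_(delta_mx 0 i) (fun=> a : R^o) x) =
    (fun _ : 'rV[R]_n => 0 : R^o) by exact: (IHk 0).
by apply/funext => x; exact: derive_cst.
Qed.

Lemma Ck_add k U f h :
  open U -> Ck k U f -> Ck k U h -> Ck k U (fun x => f x + h x).
Proof.
have cont j f1 h1 (x : 'rV[R]_n) : Ck j U f1 -> Ck j U h1 -> U x ->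
    {for x, continuous (fun y => f1 y + h1 y)}.
  move=> Cf1 Ch1 Ux; have FF := nbhs_filter x.
  exact: (cvgD (Ck_continuous Cf1 Ux) (Ck_continuous Ch1 Ux)).
move=> oU; elim: k f h => [|k IHk] f h Cf Ch; split => //.
- by move=> x Ux; exact: cont Cf Ch Ux.
- by move=> x Ux; exact: cont Cf Ch Ux.
move=> i; have [[_ /(_ i)[df Cdf]] [_ /(_ i)[dh Cdh]]] := (Cf, Ch).
split=> [x Ux|]; first by apply: derivableD; [exact: df|exact: dh].
apply: eq_Ck (IHk _ _ Cdf Cdh) => // x Ux.
by rewrite -deriveD//; [exact: df|exact: dh].
Qed.

Lemma Ck_mul k U f h :
  open U -> Ck k U f -> Ck k U h -> Ck k U (fun x => f x * h x).
Proof.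
have cont j f1 h1 (x : 'rV[R]_n) : Ck j U f1 -> Ck j U h1 -> U x ->
    {for x, continuous (fun y => f1 y * h1 y)}.
  move=> Cf1 Ch1 Ux; have FF := nbhs_filter x.
  exact: (cvgM (Ck_continuous Cf1 Ux) (Ck_continuous Ch1 Ux)).
move=> oU; elim: k f h => [|k IHk] f h Cf Ch; split => //.
- by move=> x Ux; exact: cont Cf Ch Ux.
- by move=> x Ux; exact: cont Cf Ch Ux.
move=> i; have [[_ /(_ i)[df Cdf]] [_ /(_ i)[dh Cdh]]] := (Cf, Ch).
split=> [x Ux|]; first by apply: derivableM; [exact: df|exact: dh].
apply: eq_Ck (Ck_add oU (IHk _ _ (CkW Cf) Cdh) (IHk _ _ (CkW Ch) Cdf)) => //.
by move=> x Ux; rewrite -deriveM//; [exact: df|exact: dh].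
Qed.

End SmoothEuclidean.

Record chart (R : realType) (n : nat) (M : topologicalType) := Chart {
  chart_dom : set M;
  chart_map : M -> 'rV[R]_n;
  chart_inv : 'rV[R]_n -> M;
  chart_dom_open : open chart_dom;
  chart_img_open : open (chart_map @` chart_dom);
  chart_mapK : forall p, chart_dom p -> chart_inv (chart_map p) = p;
  chart_map_continuous : {within chart_dom, continuous chart_map};
  chart_inv_continuous :
    {within chart_map @` chart_dom, continuous chart_inv} }.

Definition chart_img R n M (c : chart R n M) := chart_map c @` chart_dom c.

(* The transition map is smooth where it is defined, i.e. each of its
   coordinates is. *)
Definition compatible_charts R n M (c d : chart R n M) :=
  forall i : 'I_n, smooth_on (chart_map c @` (chart_dom c `&` chart_dom d))
    (fun x => chart_map d (chart_inv c x) ord0 i).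

(* A smooth atlas, not necessarily maximal: the maximal atlas it generates has
   the same smooth functions. *)
Record manifold (R : realType) (n : nat) := Manifold {
  carrier :> topologicalType;
  atlas : set (chart R n carrier);
  manifold_hausdorff : hausdorff_space carrier;
  manifold_second_countable : @second_countable carrier;
  atlas_cover : forall p, exists2 c, atlas c & chart_dom c p;
  atlas_compatible :
    forall c d, atlas c -> atlas d -> compatible_charts c d }.

Section SmoothFunctions.
Context {R : realType} {n : nat} (M : manifold R n).

Definition smooth (f : M -> R^o) :=
  forall c, atlas c -> smooth_on (chart_img c) (f \o chart_inv c).

Lemma smooth_cst (a : R) : smooth (fun=> a).
Proof. by move=> c _ k; exact: Ck_cst. Qed.

Lemma smooth_add f h : smooth f -> smooth h -> smooth (fun p => f p + h p).
Proof.
by move=> sf sh c ac k; apply: Ck_add (sf c ac k) (sh c ac k);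
  exact: chart_img_open.
Qed.

Lemma smooth_mul f h : smooth f -> smooth h -> smooth (fun p => f p * h p).
Proof.
by move=> sf sh c ac k; apply: Ck_mul (sf c ac k) (sh c ac k);
  exact: chart_img_open.
Qed.

Definition is_smooth : {pred M -> R^o} := fun f => `[< smooth f >].

Record smooth_fun := SmoothFun {
  smooth_fun_val :> M -> R^o;
  smooth_fun_mem : smooth_fun_val \in is_smooth }.

Definition mk_smooth (f : M -> R^o) (sf : smooth f) : smooth_fun :=
  SmoothFun (introT (asboolP _) sf).

Lemma smooth_funP (f : smooth_fun) : smooth f.
Proof. by apply/asboolP; case: f. Qed.

Lemma is_smooth_subring : subring_closed is_smooth.
Proof.
have sN (f : M -> R^o) : smooth f -> smooth (- f).
  move=> sf; rewrite (_ : - f = fun p => -1 * f p).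
    by apply: smooth_mul => //; exact: smooth_cst.
  by apply/funext => p; rewrite mulN1r.
split=> [|f h /asboolP sf /asboolP sh|f h /asboolP sf /asboolP sh].
- by apply/asboolP; exact: smooth_cst.
- by apply/asboolP; apply: smooth_add => //; exact: sN.
- by apply/asboolP; exact: smooth_mul.
Qed.

Lemma is_smooth_submod : submod_closed is_smooth.
Proof.
split=> [|a f h /asboolP sf /asboolP sh].
  by apply/asboolP; exact: smooth_cst.
apply/asboolP; apply: smooth_add => //.
by apply: smooth_mul => //; exact: smooth_cst.
Qed.

HB.instance Definition _ := [isSub for smooth_fun_val].
HB.instance Definition _ := [Choice of smooth_fun by <:].
HB.instance Definition _ :=
  GRing.isSubringClosed.Build (M -> R^o) is_smooth is_smooth_subring.
HB.instance Definition _ :=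
  GRing.isSubmodClosed.Build R (M -> R^o) is_smooth is_smooth_submod.
HB.instance Definition _ :=
  GRing.SubChoice_isSubComPzRing.Build (M -> R^o) is_smooth smooth_fun
    (subringClosedP _).
HB.instance Definition _ := [SubZmodule_isSubLmodule of smooth_fun by <:].

End SmoothFunctions.

Section TangentSpaces.
Context {R : realType} {n : nat} {M : manifold R n}.

(* Tangent vectors at p are the derivations of C^oo(M) at p. *)
Definition derivation (p : M) (v : smooth_fun M -> R^o) :=
  (forall (a : R) (f h : smooth_fun M), v (a *: f + h) = a * v f + v h) /\
  (forall f h : smooth_fun M, v (f * h) = f p * v h + h p * v f).

Definition is_derivation (p : M) : {pred smooth_fun M -> R^o} :=
  fun v => `[< derivation p v >].

Record tangent (p : M) := Tangent {
  tangent_val :> smooth_fun M -> R^o;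
  tangent_mem : tangent_val \in is_derivation p }.

Lemma is_derivation_submod (p : M) : submod_closed (is_derivation p).
Proof.
split=> [|a v w /asboolP[lv dv] /asboolP[lw dw]]; apply/asboolP.
  by split=> [a f h|f h]; [exact/esym/(etrans (addr0 _))/mulr0|
    exact/esym/(etrans (congr2 _ (mulr0 _) (mulr0 _)))/addr0].
have E f : (a *: v + w) f = a * v f + w f by [].
split=> [b f h|f h]; rewrite !E ?(lv, lw) ?(dv, dw) !mulrDr addrACA.
  by congr (_ + _ + _); rewrite mulrCA.
by congr (_ + _); congr (_ + _); rewrite mulrCA.
Qed.

HB.instance Definition _ p := [isSub for @tangent_val p].
HB.instance Definition _ p := [Choice of tangent p by <:].
HB.instance Definition _ p := GRing.isSubmodClosed.Build R
  (smooth_fun M -> R^o) (is_derivation p) (is_derivation_submod p).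
HB.instance Definition _ p := [SubChoice_isSubLmodule of tangent p by <:].

End TangentSpaces.

Section VectorFields.
Context {R : realType} {n : nat} (M : manifold R n).

Record vfield := VField {
  vfield_val :> forall p : M, tangent p;
  vfield_smooth : forall f : smooth_fun M, smooth (fun p => vfield_val p f) }.

(* The derivative X f, which is also the covariant derivative of f along X. *)
Definition vf_deriv (X : vfield) (f : smooth_fun M) : smooth_fun M :=
  mk_smooth (vfield_smooth X f).

Lemma vf_add_smooth (X Y : vfield) (f : smooth_fun M) :
  smooth (fun p => (X p + Y p) f).
Proof. exact: smooth_add (vfield_smooth X f) (vfield_smooth Y f). Qed.

Definition vf_add (X Y : vfield) : vfield := VField (vf_add_smooth X Y).

Lemma vf_scale_smooth (h : smooth_fun M) (X : vfield) (f : smooth_fun M) :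
  smooth (fun p => ((h p : R) *: X p) f).
Proof. exact: smooth_mul (smooth_funP h) (vfield_smooth X f). Qed.

Definition vf_scale (h : smooth_fun M) (X : vfield) : vfield :=
  VField (vf_scale_smooth h X).

Definition eval_at k (p : M) (Xs : k.-tuple vfield) : k.-tuple (tangent p) :=
  map_tuple (fun X : vfield => X p) Xs.

(* Smoothness of a tensor field is tested on global vector fields, which is
   equivalent to smoothness in charts since a Hausdorff second countable
   manifold has bump functions. *)
Record dform (k : nat) := DForm {
  dform_val :> forall p : M, kform k (tangent p);
  dform_alternating : forall p, alternating_form (@dform_val p);
  dform_smooth : forall Xs : k.-tuple vfield,
    smooth (fun p => @dform_val p (eval_at p Xs)) }.

Definition dform_fun k (w : dform k) (Xs : k.-tuple vfield) : smooth_fun M :=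
  mk_smooth (dform_smooth w Xs).

Record tensor2 := Tensor2 {
  tensor2_val :> forall p : M, tangent p -> tangent p -> R;
  tensor2_bilinear : forall p, bilinear_form (@tensor2_val p);
  tensor2_smooth : forall X Y : vfield,
    smooth (fun p => @tensor2_val p (X p) (Y p)) }.

Definition tensor2_fun (t : tensor2) (X Y : vfield) : smooth_fun M :=
  mk_smooth (tensor2_smooth t X Y).

Definition riemannian_metric (g : tensor2) := forall p, inner_product (g p).

Definition connection (nabla : vfield -> vfield -> vfield) :=
  [/\ forall (f : smooth_fun M) (X Y Z : vfield) (p : M),
        nabla (vf_add (vf_scale f X) Y) Z p =
        (f p : R) *: nabla X Z p + nabla Y Z p,
      forall (X Y Z : vfield) (p : M),
        nabla X (vf_add Y Z) p = nabla X Y p + nabla X Z p &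
      forall (f : smooth_fun M) (X Y : vfield) (p : M),
        nabla X (vf_scale f Y) p =
        (vf_deriv X f p : R) *: Y p + (f p : R) *: nabla X Y p].

(* nabla_X Y - nabla_Y X = [X, Y], both sides being applied to functions. *)
Definition torsion_free (nabla : vfield -> vfield -> vfield) :=
  forall (X Y : vfield) (f : smooth_fun M) (p : M),
    nabla X Y p f - nabla Y X p f =
    vf_deriv X (vf_deriv Y f) p - vf_deriv Y (vf_deriv X f) p.

Definition metric_connection (g : tensor2)
    (nabla : vfield -> vfield -> vfield) :=
  forall (X Y Z : vfield) (p : M),
    vf_deriv X (tensor2_fun g Y Z) p =
    g p (nabla X Y p) (Z p) + g p (Y p) (nabla X Z p).

Definition levi_civita (g : tensor2) (nabla : vfield -> vfield -> vfield) :=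
  [/\ connection nabla, torsion_free nabla & metric_connection g nabla].

(* (nabla_X w)(Y_1, ..., Y_k) *)
Definition dform_deriv (nabla : vfield -> vfield -> vfield) k (w : dform k)
    (X : vfield) (Ys : k.-tuple vfield) (p : M) : R :=
  vf_deriv X (dform_fun w Ys) p -
  \sum_(i < k) w p (eval_at p (subst_tuple Ys i (nabla X (tnth Ys i)))).

Record oct_section := OctSection {
  oct_re : smooth_fun M;
  oct_im : vfield }.

Definition oct_at (A : oct_section) (p : M) : R^o * tangent p :=
  (oct_re A p, oct_im A p).

Lemma oct_inner_smooth (g : tensor2) (A B : oct_section) :
  smooth (fun p => oct_inner (g p) (oct_at A p) (oct_at B p)).
Proof.
apply: smooth_add (tensor2_smooth g (oct_im A) (oct_im B)).
exact: smooth_mul (smooth_funP (oct_re A)) (smooth_funP (oct_re B)).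
Qed.

(* The function g(A, B). *)
Definition oct_inner_fun (g : tensor2) (A B : oct_section) : smooth_fun M :=
  mk_smooth (oct_inner_smooth g A B).

Definition oct_nabla (nabla : vfield -> vfield -> vfield) (X : vfield)
    (A : oct_section) (p : M) : R^o * tangent p :=
  (vf_deriv X (oct_re A) p, nabla X (oct_im A) p).

End VectorFields.

Section G2Structures.
Context {R : realType} (M : manifold R 7).

Definition G2_structure (phi : dform M 3) := forall p, positive_3form (phi p).

Definition G2_metric_volume (phi : dform M 3) (g : tensor2 M)
    (vol : dform M 7) :=
  riemannian_metric g /\ forall p, metric_volume_of (phi p) (g p) (vol p).

Definition hodge_star_of (g : tensor2 M) (vol : dform M 7) (phi : dform M 3)
    (psi : dform M 4) :=
  forall p, hodge_dual (k := 3) (l := 4) (g p) (vol p) (phi p) (psi p).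

(* The vector field X _| T, i.e. X^a T_a^b. *)
Definition torsion_vector (g T : tensor2 M) (X : vfield M) (p : M) : tangent p :=
  sharp (g p) (T p (X p)).

(* nabla_a phi_bcd = 2 T_a^e psi_ebcd *)
Definition torsion_tensor (g : tensor2 M) (nabla : vfield M -> vfield M -> vfield M)
    (phi : dform M 3) (psi : dform M 4) (T : tensor2 M) :=
  forall (X Y Z W : vfield M) (p : M),
    dform_deriv nabla phi X [tuple Y; Z; W] p =
    2%:R * psi p [tuple torsion_vector g T X p; Y p; Z p; W p].

(* D_X A = nabla_X A - A T_X, evaluated at p, where T_X = (0, X _| T). *)
Definition octonion_D (g : tensor2 M) (phi : dform M 3)
    (nabla : vfield M -> vfield M -> vfield M) (T : tensor2 M) (X : vfield M)
    (A : oct_section M) (p : M) : R^o * tangent p :=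
  oct_nabla nabla X A p -
  oct_mul (g p) (phi p) (oct_at A p) (0, torsion_vector g T X p).

End G2Structures.

(* Main.v *)
Require Import Defs.
From mathcomp Require Import all_boot all_order all_algebra.
From mathcomp Require Import all_classical all_reals all_analysis.
Import Order.TTheory GRing.Theory Num.Theory.
Local Open Scope ring_scope.

(** At a point, [D_X] differs from [nabla_X] by right multiplication by the
    imaginary octonion [T_X]. Since [nabla_X] is compatible with the metric of
    the octonion bundle, it suffices that right multiplication by an imaginary
    octonion is skew-adjoint, and this follows from
    [g (u x t) v = phi (u, t, v) = - phi (v, t, u)]. *)

Section InnerProduct.
Context {R : realType} {V : lmodType R} {g : V -> V -> R}.
Hypothesis g_inner : inner_product g.

Lemma bilinear_sumZl n (t : V -> V -> R) (a : 'I_n -> R) (e : 'I_n -> V) v :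
  bilinear_form t -> t (\sum_i a i *: e i) v = \sum_i a i * t (e i) v.
Proof.
case=> tl _.
(* Linearity is only available in the form [a *: u + v]; taking [a = -1] and both vectors zero gives
   the value at 0. *)
have t0 : t 0 v = 0.
  by have := tl (-1) 0 0 v; rewrite scaler0 addr0 mulN1r addNr.
by elim/big_rec2: _ => // i x y _ <-; rewrite tl.
Qed.

(** Riesz representation in finite dimension: in the basis that [L] carries to the standard one,
    finding [u] means solving a linear system whose matrix is the Gram matrix of [g]. *)
Lemma inner_product_representable n (L : {linear V -> 'rV[R]_n}) (w : V -> R) :
  bijective L -> (forall (a : R) u v, w (a *: u + v) = a * w u + w v) ->
  exists u, forall v, g u v = w v.
Proof.
move=> [K LK KL] lw; have [bg gC g_gt0] := g_inner.
pose e i := K (delta_mx 0 i).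
have eE (x : 'rV[R]_n) : K x = \sum_i x 0 i *: e i.
  apply: (can_inj LK); rewrite KL linear_sum [LHS]row_sum_delta.
  by apply: eq_bigr => i _; rewrite linearZ /= KL.
have wE (x : 'rV[R]_n) : w (K x) = \sum_i x 0 i * w (e i).
  rewrite eE; elim/big_rec2: _ => [|i y z _ <-]; last by rewrite lw.
  by have := lw (-1) 0 0; rewrite scaler0 addr0 mulN1r addNr.
pose G := \matrix_(i, j) g (e i) (e j).
have GE x j : (x *m G) 0 j = g (K x) (e j).
  by rewrite eE bilinear_sumZl // !mxE; apply: eq_bigr => i _; rewrite !mxE.
have gE x v : g (K x) v = \sum_j (L v) 0 j * (x *m G) 0 j.
  rewrite gC -[in LHS](LK v) eE bilinear_sumZl //.
  by apply: eq_bigr => j _; rewrite GE gC.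
(* If [x *m G = 0] then [g (K x) (K x) = 0], so positive definiteness forces [K x = 0], hence
   [x = 0]. *)
have G_unit : G \in unitmx.
  rewrite -row_free_unit -kermx_eq0; apply/rowV0P => x /sub_kermxP xG.
  apply: (can_inj KL); apply/eqP; have [//|Kx0] := eqVneq (K x) (K 0).
  have K0 : K 0 = 0 by rewrite -[RHS]LK linear0.
  have := g_gt0 (K x); rewrite -K0 => /(_ Kx0).
  by rewrite gE xG big1 ?ltxx // => j _; rewrite mxE mulr0.
exists (K ((\row_j w (e j)) *m invmx G)) => v.
rewrite gE mulmxKV // -[in RHS](LK v) wE.
by apply: eq_bigr => j _; rewrite !mxE.
Qed.

(** Representability rules out the default branch of [xget]. *)
Lemma sharpP (w : V -> R) :
  (exists u, forall v, g u v = w v) -> forall v, g (sharp g w) v = w v.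
Proof. by move=> [u uP]; rewrite /sharp; case: xgetP => [y _ //|/(_ u)]. Qed.

Lemma oct_innerBl (x y z : R^o * V) :
  oct_inner g (x - y) z = oct_inner g x z - oct_inner g y z.
Proof.
have [[gl _] _ _] := g_inner; rewrite /oct_inner /=.
by rewrite mulrBl [x.2 - _]addrC -scaleN1r gl mulN1r [- g _ _ + _]addrC opprD addrACA.
Qed.

Lemma oct_innerBr (x y z : R^o * V) :
  oct_inner g z (x - y) = oct_inner g z x - oct_inner g z y.
Proof.
have [_ gC _] := g_inner.
have oC u v : oct_inner g u v = oct_inner g v u.
  by rewrite /oct_inner gC; congr (_ + _); exact: mulrC.
by rewrite oC oct_innerBl !(oC z).
Qed.

End InnerProduct.

Section OctonionAlgebra.
Context {R : realType} {V : lmodType R} {phi : kform 3 V}.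
Hypothesis phi_alt : alternating_form phi.

Let phi_lin1 a x y u v :
  phi [tuple a *: x + y; u; v] = a * phi [tuple x; u; v] + phi [tuple y; u; v].
Proof.
have E z : subst_tuple [tuple 0; u; v] 0 z = [tuple z; u; v].
  by apply: eq_from_tnth => i; rewrite tnth_mktuple; case: i => [[|[|[]]]].
by have := phi_alt.1 [tuple 0; u; v] 0 a x y; rewrite !E.
Qed.

Lemma alternating3_lin3 a x y u v :
  phi [tuple u; v; a *: x + y] = a * phi [tuple u; v; x] + phi [tuple u; v; y].
Proof.
have E z : subst_tuple [tuple u; v; 0] ord_max z = [tuple u; v; z].
  by apply: eq_from_tnth => i; rewrite tnth_mktuple; case: i => [[|[|[]]]].
by have := phi_alt.1 [tuple u; v; 0] ord_max a x y; rewrite !E.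
Qed.

(** Polarisation: expand [phi] on [u + v], [t], [u + v], which vanishes. *)
Lemma alternating3_swap13 u t v : phi [tuple u; t; v] = - phi [tuple v; t; u].
Proof.
have diag x : phi [tuple x; t; x] = 0 by exact: (phi_alt.2 _ 0 ord_max).
have := diag (1 *: u + v).
rewrite phi_lin1 !alternating3_lin3 !diag !mul1r add0r addr0.
by move/eqP; rewrite addr_eq0 => /eqP.
Qed.

Context {g : V -> V -> R}.
Hypotheses (g_inner : inner_product g) (phi_pos : positive_3form phi).

(** Positivity of [phi] supplies a linear isomorphism with R^7, hence the finite dimension that
    representability requires. *)
Lemma cross_productP u v w : g (cross_product g phi u v) w = phi [tuple u; v; w].
Proof.
have [L L_bij _] := phi_pos.
apply: sharpP; apply: inner_product_representable L_bij _ => // a x y.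
exact: alternating3_lin3.
Qed.

(** The left side is [x.1 * g t y.2 - y.1 * g x.2 t + phi [tuple x.2; t; y.2]], which changes sign
    when [x] and [y] are exchanged. *)
Lemma oct_inner_mul_imag (x y : R^o * V) (t : V) :
  oct_inner g (oct_mul g phi x (0, t)) y =
  - oct_inner g x (oct_mul g phi y (0, t)).
Proof.
have [[gl gr] gC _] := g_inner.
have gD u v w : g (u + v) w = g u w + g v w.
  by have := gl 1 u v w; rewrite scale1r mul1r.
have gZ a u w : g (a *: u) w = a * g u w.
  have := gl a u 0 w; rewrite addr0 => ->.
  by have := gl (-1) 0 0 w; rewrite scaler0 addr0 mulN1r addNr => ->; rewrite addr0.
rewrite /oct_inner /oct_mul /= !scale0r !addr0 !mulr0 !sub0r.
rewrite [g x.2 (_ + _)]gC !gD !gZ !cross_productP (alternating3_swap13 y.2).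
rewrite [g y.2 t]gC [g x.2 t]gC [g t y.2]gC mulrN mulNr !opprD !opprK.
by rewrite [y.1 * _]mulrC addrCA addrA.
Qed.

End OctonionAlgebra.

(** The real parts obey the Leibniz rule of the derivation [X p], the imaginary parts metric
    compatibility of [nabla]. *)
Lemma vf_deriv_oct_inner (R : realType) n (M : manifold R n) (g : tensor2 M)
    (nabla : vfield M -> vfield M -> vfield M) (A B : oct_section M)
    (X : vfield M) (p : M) :
  metric_connection g nabla ->
  vf_deriv X (oct_inner_fun g A B) p =
  oct_inner (g p) (oct_nabla nabla X A p) (oct_at B p) +
  oct_inner (g p) (oct_at A p) (oct_nabla nabla X B p).
Proof.
move=> nabla_g.
(* The factor [1 *:] gives the sum the shape of the linearity clause of [derivation]. *)
have -> : oct_inner_fun g A B =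
    1 *: (oct_re A * oct_re B) + tensor2_fun g (oct_im A) (oct_im B).
  by rewrite scale1r; exact: val_inj.
have /asboolP[Xl XM] := tangent_mem (X p).
have := nabla_g X (oct_im A) (oct_im B) p.
rewrite /vf_deriv /= Xl XM => ->.
rewrite /oct_inner /= mul1r [X in X + _]addrC addrACA.
by congr (_ + _); congr (_ + _); exact: mulrC.
Qed.

Theorem proposition6p5 (R : realType) (M : manifold R 7)
    (phi : dform M 3) (phi_G2 : G2_structure phi)
    (g : tensor2 M) (vol : dform M 7) (g_vol : G2_metric_volume phi g vol)
    (nabla : vfield M -> vfield M -> vfield M) (nabla_LC : levi_civita g nabla)
    (psi : dform M 4) (psi_star : hodge_star_of g vol phi psi)
    (T : tensor2 M) (T_torsion : torsion_tensor g nabla phi psi T)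
    (A B : oct_section M) (X : vfield M) (p : M) :
  vf_deriv X (oct_inner_fun g A B) p =
  oct_inner (g p) (octonion_D g phi nabla T X A p) (oct_at B p) +
  oct_inner (g p) (oct_at A p) (octonion_D g phi nabla T X B p).
Proof.
have [_ _ nabla_g] := nabla_LC.
have g_inner := g_vol.1 p.
rewrite (vf_deriv_oct_inner _ _ _ _ _ _ _ _ _ nabla_g).
rewrite /octonion_D (oct_innerBl g_inner) (oct_innerBr g_inner).
(* Moving [T_X] from [A] to [B] costs a sign, so the two torsion terms cancel. *)
rewrite (oct_inner_mul_imag (dform_alternating phi p) g_inner (phi_G2 p)).
by rewrite opprK [RHS]addrACA addrN addr0.
Qed.
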